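(* Let $R$ be a $G$-graded commutative ring, $M$ a $G$-graded $R$-module, and $N$ a graded $R$-submodule of $M$. Let $\mathfrak{D}_N=\{(N:_Mt) : t\in h^*(R)\setminus(N:_RM)\}$. If $s\in h^*(R)\setminus (N:_RM)$ is such that $(N:_Ms)$ is a maximal element of $\mathfrak{D}_N$ with respect to inclusion, then $(N:_Ms)\in GSpec({}_RM)$, and thus $N\in GSpec_s({}_RM)$.
   Context: $G$ is a group with identity $e$; rings are commutative with nonzero unity $1$ and modules are unital. A ring $R$ is $G$-graded if $R=\bigoplus_{g\in G}R_g$ with additive subgroups $R_g$ satisfying $R_gR_h\subseteq R_{gh}$; $h(R)=\bigcup_{g\in G}R_g$ and $h^*(R)=h(R)\setminus\{0\}$. An $R$-module $M$ is $G$-graded if $M=\bigoplus_{g\in G}M_g$ with additive subgroups $M_g$ satisfying $R_gM_h\subseteq M_{gh}$; $h(M)=\bigcup_{g\in G}M_g$. A submodule $N$ of $M$ is graded if $N=\bigoplus_{g\in G}(N\cap M_g)$. Write $(N:_RM)=\{r\in R: rM\subseteq N\}$ and, for $t\in R$, $(N:_Mt)=\{m\in M: tm\in N\}$. A graded prime submodule is a proper graded $R$-submodule $N$ of $M$ such that for all $r\in h(R)$, $m\in h(M)$, $rm\in N$ implies $r\in(N:_RM)$ or $m\in N$; $GSpec({}_RM)$ is the set of these. For $s\in h^*(R)$, a graded $R$-submodule $N$ of $M$ is graded $s$-prime if $s\notin(N:_RM)$ and, for all $r\in h(R)$ and $m\in h(M)$, $rm\in N$ implies $sr\in(N:_RM)$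 or $sm\in N$; $GSpec_s({}_RM)$ is the set of these. *)

(* Defs.v *)
From mathcomp Require Import all_boot all_algebra.
From mathcomp Require Import boolp classical_sets.

Set Implicit Arguments.
Unset Strict Implicit.
Unset Printing Implicit Defensive.

Import GRing.Theory.

Local Open Scope classical_set_scope.
Local Open Scope ring_scope.

Section DirectSum.
Context {I : choiceType} {V : zmodType}.

(* [N] is the internal direct sum of the additive subgroups [A i]: its elements
   are the finite sums of elements of the [A i], and a finite sum of elements
   taken from distinct [A i] vanishes only if all its terms do. *)
Definition is_direct_sum (N : set V) (A : I -> set V) : Prop :=
  [/\ forall i, zmod_closed [in A i],
      N = [set x | exists (r : seq I) (f : I -> V),
                     (forall i, A i (f i)) /\ x = \sum_(i <- r) f i]
    & forall (r : seq I) (f : I -> V), uniq r -> (forall i, A i (f i)) ->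
        \sum_(i <- r) f i = 0 -> {in r, forall i, f i = 0}].

Definition homogeneous (A : I -> set V) : set V := \bigcup_(i in [set: I]) A i.

Definition nz_homogeneous (A : I -> set V) : set V :=
  homogeneous A `\` [set 0].

End DirectSum.

Section Graded.
Context {G : groupType} {R : comNzRingType} {M : lmodType R}.

Definition ring_grading (Rg : G -> set R) : Prop :=
  is_direct_sum setT Rg /\
  forall g h x y, Rg g x -> Rg h y -> Rg (g * h)%g (x * y).

Definition module_grading (Rg : G -> set R) (Mg : G -> set M) : Prop :=
  is_direct_sum setT Mg /\
  forall g h x m, Rg g x -> Mg h m -> Mg (g * h)%g (x *: m).

Definition graded_submodule (Mg : G -> set M) (N : set M) : Prop :=
  submod_closed [in N] /\ is_direct_sum N (fun g => N `&` Mg g).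

Definition colon_ring (N : set M) : set R := [set r | forall m : M, N (r *: m)].

Definition colon_mod (N : set M) (t : R) : set M := [set m | N (t *: m)].

Definition GSpec (Rg : G -> set R) (Mg : G -> set M) : set (set M) :=
  [set N | [/\ graded_submodule Mg N,
               N <> setT
             & forall r m, homogeneous Rg r -> homogeneous Mg m ->
                 N (r *: m) -> colon_ring N r \/ N m]].

(* Meant for [s] in [nz_homogeneous Rg]. *)
Definition GSpec_s (Rg : G -> set R) (Mg : G -> set M) (s : R) : set (set M) :=
  [set N | [/\ graded_submodule Mg N,
               ~ colon_ring N s
             & forall r m, homogeneous Rg r -> homogeneous Mg m ->
                 N (r *: m) -> colon_ring N (s * r) \/ N (s *: m)]].

Definition colon_family (Rg : G -> set R) (N : set M) : set (set M) :=
  [set colon_mod N t | t in nz_homogeneous Rg `\` colon_ring N].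

End Graded.

Definition maximal_in {T : Type} (F : set (set T)) (A : set T) : Prop :=
  F A /\ forall B, F B -> A `<=` B -> B = A.

(* Main.v *)
(*
  If [r m] lies in [(N : s)] while [r] is not in [((N : s) : M)], then [r s] is
  homogeneous and outside [(N : M)], so [(N : r s)] is a member of the family
  containing [(N : s)]; by maximality they coincide, and [m] lies in
  [(N : r s) = (N : s)]. That [(N : s)] is graded holds because
  multiplication by [s], of degree [h], sends the components of an element [x]
  to the components of [s x], shifting the degree by the injection
  [g |-> h g]. *)
Require Import Defs.
From mathcomp Require Import all_boot all_algebra.
From mathcomp Require Import boolp classical_sets.

Local Open Scope classical_set_scope.
Local Open Scope ring_scope.

Import GRing.Theory.

Section DirectSumTheory.
Context {I : choiceType} {V : zmodType}.
Implicit Types (A : I -> set V) (N : set V).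

Lemma zmod_closed_set N : zmod_closed [in N] ->
  [/\ N 0, forall x y, N x -> N y -> N (x - y)
    & forall x y, N x -> N y -> N (x + y)].
Proof.
case=> N0 NB; have {}N0 : N 0 by exact: set_mem.
have {}NB x y : N x -> N y -> N (x - y).
  by move=> Nx Ny; apply: set_mem; apply: NB; exact: mem_set.
split=> // x y Nx Ny; rewrite -[y]opprK; apply: (NB) => //.
by rewrite -sub0r; exact: NB.
Qed.

Lemma set_zmod_closed N : N 0 -> (forall x y, N x -> N y -> N (x - y)) ->
  zmod_closed [in N].
Proof.
move=> N0 NB; split; first exact: mem_set.
by move=> x y /set_mem Nx /set_mem Ny; apply: mem_set; exact: NB.
Qed.

(** The index list of a finite sum may repeat entries, whereas the independence clause of
    [is_direct_sum] needs [uniq]. Repetitions are absorbed by multiplying each term by its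
    multiplicity, which stays in the subgroup [A i]. *)
Lemma direct_sum_uniq A N x : is_direct_sum N A -> N x ->
  exists (r : seq I) (f : I -> V),
    [/\ uniq r, forall i, A i (f i) & x = \sum_(i <- r) f i].
Proof.
case=> Acl -> _ [r [f [Af ->]]].
exists (undup r), (fun i => f i *+ count_mem i r); split.
- exact: undup_uniq.
- move=> i; have [A0 _ AD] := zmod_closed_set _ (Acl i).
  elim: (count_mem i r) => [|n IHn]; first by rewrite mulr0n.
  by rewrite mulrS; apply: AD.
- by rewrite -big_undup_iterop_count.
Qed.

(** Uniqueness of components: both families are extended by zero to the union of their index lists,
    and independence is applied to the difference. *)
Lemma direct_sum_component_inj A (r1 r2 : seq I) (f1 f2 : I -> V) :
  is_direct_sum setT A -> uniq r1 -> uniq r2 ->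
  (forall i, A i (f1 i)) -> (forall i, A i (f2 i)) ->
  \sum_(i <- r1) f1 i = \sum_(i <- r2) f2 i ->
  {in r1, forall i, f1 i = if i \in r2 then f2 i else 0}.
Proof.
case=> Acl _ Ainj u1 u2 Af1 Af2 eq12 i ir1.
pose f i := (if i \in r1 then f1 i else 0) - (if i \in r2 then f2 i else 0).
have restrict (r : seq I) (g : I -> V) : uniq r -> {subset r <= r1 ++ r2} ->
    \sum_(i <- undup (r1 ++ r2)) (if i \in r then g i else 0)
    = \sum_(i <- r) g i.
  move=> ur rs; rewrite -big_mkcond -big_filter; apply: perm_big.
  apply: uniq_perm => //; first by rewrite filter_uniq ?undup_uniq.
  move=> j; rewrite mem_filter mem_undup.
  by case: (boolP (j \in r)) => //= /rs ->.
suff: f i = 0 by rewrite /f ir1 => /eqP; rewrite subr_eq0 => /eqP.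
apply: (Ainj (undup (r1 ++ r2)) f); rewrite ?undup_uniq //.
- move=> j; have [A0 AB _] := zmod_closed_set _ (Acl j).
  by apply: AB; case: ifP.
- by rewrite sumrB !restrict ?eq12 ?subrr // => j jr; rewrite mem_cat jr ?orbT.
- by rewrite mem_undup mem_cat ir1.
Qed.

(** The sum has a second expansion, with terms in [N]; by uniqueness of components [f i] is one of
    these terms or [0]. *)
Lemma graded_component_mem A N (r : seq I) (f : I -> V) :
  is_direct_sum setT A -> is_direct_sum N (fun i => N `&` A i) ->
  N 0 -> uniq r -> (forall i, A i (f i)) ->
  N (\sum_(i <- r) f i) -> {in r, forall i, N (f i)}.
Proof.
move=> dA dN N0 ur Af Nf i ir.
have [r' [f' [ur' Nf' eqf]]] := direct_sum_uniq _ _ _ dN Nf.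
have Af' j : A j (f' j) by case: (Nf' j).
rewrite (direct_sum_component_inj _ _ _ _ _ dA ur ur' Af Af' eqf i ir).
by case: ifP => // _; case: (Nf' i).
Qed.

(** Converse of [graded_component_mem]: a subgroup containing the components of its elements
    inherits the decomposition, and independence passes down from the ambient one. *)
Lemma is_direct_sum_components A N :
  is_direct_sum setT A -> zmod_closed [in N] ->
  (forall (r : seq I) (f : I -> V), uniq r -> (forall i, A i (f i)) ->
     N (\sum_(i <- r) f i) -> {in r, forall i, N (f i)}) ->
  is_direct_sum N (fun i => N `&` A i).
Proof.
move=> dA Ncl Ncomp; have [Acl _ Ainj] := dA.
have [N0 NB ND] := zmod_closed_set _ Ncl.
split.
- move=> i; have [A0 AB _] := zmod_closed_set _ (Acl i).
  apply: set_zmod_closed; first by split.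
  by move=> x y [Nx Ax] [Ny Ay]; split; [exact: NB | exact: AB].
- apply/seteqP; split=> [x Nx|x [r [f [NAf ->]]]].
  + have [r [f [ur Af eqx]]] := direct_sum_uniq _ _ x dA Logic.I.
    (* Membership in [N] is required at every index but known only on [r], hence the value [0]
       elsewhere. *)
    exists r, (fun i => if i \in r then f i else 0); split.
      move=> i; have [A0 _ _] := zmod_closed_set _ (Acl i).
      case: ifP => ir; split => //.
      by apply: (Ncomp r f) => //; rewrite -eqx.
    by rewrite eqx big_seq [RHS]big_seq; apply: eq_bigr => i ->.
  + elim/big_rec: _ => // i y _ Ny; apply: ND => //.
    by case: (NAf i).
- move=> r f ur NAf; apply: Ainj => // i.
  by case: (NAf i).
Qed.

End DirectSumTheory.

Section GradedTheory.
Context {G : groupType} {R : comNzRingType} {M : lmodType R}.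
Implicit Types (Rg : G -> set R) (Mg : G -> set M) (N : set M).

Lemma submod_closed_set N : submod_closed [in N] ->
  [/\ N 0, forall x y, N x -> N y -> N (x - y)
    & forall a x, N x -> N (a *: x)].
Proof.
case=> N0 Nlin; have {}N0 : N 0 by exact: set_mem.
have {}Nlin a x y : N x -> N y -> N (a *: x + y).
  by move=> Nx Ny; apply: set_mem; apply: Nlin; exact: mem_set.
split=> // [x y Nx Ny|a x Nx]; last by rewrite -[a *: x]addr0; exact: Nlin.
by rewrite addrC -scaleN1r; exact: Nlin.
Qed.

Lemma submod_closed_colon_mod N (t : R) :
  submod_closed [in N] -> submod_closed [in colon_mod N t].
Proof.
case=> N0 Nlin; split.
  by apply: mem_set; rewrite /colon_mod /= scaler0; exact: set_mem.
move=> a x y /set_mem Nx /set_mem Ny; apply: mem_set; rewrite /colon_mod /=.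
rewrite scalerDr scalerA mulrC -scalerA; apply: set_mem.
by apply: Nlin; exact: mem_set.
Qed.

Lemma graded_submodule_colon_mod Rg Mg N (s : R) :
  module_grading Rg Mg -> graded_submodule Mg N -> homogeneous Rg s ->
  graded_submodule Mg (colon_mod N s).
Proof.
move=> [dM MgZ] [Nsub dN] [h _ Rs].
have Ksub := submod_closed_colon_mod _ s Nsub.
have [N0 _ _] := submod_closed_set _ Nsub.
have [K0 KB _] := submod_closed_set _ Ksub.
split=> //; apply: is_direct_sum_components => //; first exact: set_zmod_closed.
move=> r f ur Mf Kf i ir; rewrite /colon_mod /=.
(* Reindexing by the inverse shift puts [f' j] in degree [j], so [f'] is the family of components of
   [s] times the given sum. *)
pose f' j := s *: f (h^-1 * j)%g.
have f'E j : f' (h * j)%g = s *: f j by rewrite /f' mulKg.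
rewrite -f'E; apply: (graded_component_mem Mg N [seq (h * j)%g | j <- r] f') => //.
- by rewrite map_inj_uniq //; exact: mulgI.
- by move=> j; rewrite -{1}[j](mulVKg h); exact: MgZ.
- rewrite big_map (eq_bigr (fun j => s *: f j)) => [|j _]; last exact: f'E.
  by rewrite -scaler_sumr.
- exact: map_f.
Qed.

Lemma homogeneousM Rg (x y : R) : ring_grading Rg ->
  homogeneous Rg x -> homogeneous Rg y -> homogeneous Rg (x * y).
Proof. by move=> [_ RgM] [g _ xg] [h _ yh]; exists (g * h)%g => //; exact: RgM. Qed.

(** If [r *: m] is in [N], so is [s *: (r *: m)], and primeness of [colon_mod N s] applies to [r]
    and [m]. *)
Lemma GSpec_colon_mod_GSpec_s Rg Mg N (s : R) :
  graded_submodule Mg N -> ~ colon_ring N s ->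
  GSpec Rg Mg (colon_mod N s) -> GSpec_s Rg Mg s N.
Proof.
move=> gN Ns [_ _ Kprime]; split=> // r m hr hm Nrm.
have [_ _ NZ] := submod_closed_set _ gN.1.
case: (Kprime r m hr hm (NZ s _ Nrm)) => [Kr|Km]; [left|by right].
by move=> x; rewrite -scalerA; exact: Kr.
Qed.

End GradedTheory.

Theorem theorem4p4 (G : groupType) (R : comNzRingType) (M : lmodType R)
    (Rg : G -> set R) (Mg : G -> set M) (N : set M) (s : R) :
  ring_grading Rg -> module_grading Rg Mg -> graded_submodule Mg N ->
  (nz_homogeneous Rg `\` colon_ring N) s ->
  maximal_in (colon_family Rg N) (colon_mod N s) ->
  GSpec Rg Mg (colon_mod N s) /\ GSpec_s Rg Mg s N.
Proof.
move=> gR gM gN [[hs _] Ns] [_ Kmax].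
have [N0 _ NZ] := submod_closed_set _ gN.1.
suff KG : GSpec Rg Mg (colon_mod N s).
  by split=> //; exact: GSpec_colon_mod_GSpec_s.
split; first exact: (graded_submodule_colon_mod Rg).
- by move=> KT; apply: Ns => m; have : colon_mod N s m by rewrite KT.
move=> r m hr hm Krm; have [Nrs|Nrs] := pselect (colon_ring N (r * s)).
  by left=> x; rewrite /colon_mod /= scalerA mulrC; exact: Nrs.
right; rewrite -(Kmax (colon_mod N (r * s))).
- by rewrite /colon_mod /= mulrC -scalerA.
- exists (r * s) => //; split=> //; split; first exact: homogeneousM.
  (* The product is nonzero because [0] always lies in [colon_ring N]. *)
  by move=> /= rs0; apply: Nrs => x; rewrite rs0 scale0r.
- by move=> x Kx; rewrite /colon_mod /= -scalerA; exact: NZ.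
Qed.
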